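(* Let $R$ be an integral domain (not a field) that is finitely stable and an LPI-domain, and assume every fractional overring of $R$ is an LPI-domain. Then $R$ has finite character.
   Context: Let $R$ be an integral domain with quotient field $K\neq R$. An overring of $R$ is a domain $D$ with $R\subseteq D\subseteq K$; it is fractional if there is a nonzero $d\in R$ with $dD\subseteq R$. For a nonzero ideal $I$ of $R$, $E(I):=(I:I)=\{x\in K: xI\subseteq I\}$. An ideal $I$ of a domain is locally principal if $IR_M$ is principal for every maximal ideal $M$; it is invertible if $I(R:I)=R$, where $(R:I)=\{x\in K: xI\subseteq R\}$. A domain is an LPI-domain if every locally principal nonzero ideal of it is invertible. A nonzero ideal $I$ is stable if it is invertible as an ideal of the ring $E(I)$; $R$ is finitely stable if every nonzero finitely generated ideal of $R$ is stable. $R$ has finite character if every nonzero element of $R$ lies in only finitely many maximal ideals of $R$. *)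

(* Defs.v *)
(* An integral domain R with quotient field K is modelled as
   a subring R (a Prop-valued subset) of a field K such that every element of
   K is a quotient of elements of R.  Overrings, ideals, etc. are subsets of K. *)
From HB Require Import structures.
From mathcomp Require Import all_boot all_order all_algebra.
From Stdlib Require List.
Set Implicit Arguments. Unset Strict Implicit. Unset Printing Implicit Defensive.
Import GRing.Theory.
Local Open Scope ring_scope.

Section Defs.
Variable K : fieldType.

Definition subset_of (A B : K -> Prop) := forall x, A x -> B x.
Definition set_eq (A B : K -> Prop) := forall x, A x <-> B x.

Definition subring (D : K -> Prop) : Prop :=
  D 0 /\ D 1 /\ (forall x y, D x -> D y -> D (x - y)) /\
  (forall x y, D x -> D y -> D (x + y)) /\ (forall x y, D x -> D y -> D (x * y)).

Definition is_quotient_field (R : K -> Prop) : Prop :=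
  forall x : K, exists a b, R a /\ R b /\ b != 0 /\ x = a / b.

Definition overring (R D : K -> Prop) : Prop := subring D /\ subset_of R D.

Definition fractional_overring (R D : K -> Prop) : Prop :=
  overring R D /\ exists d, R d /\ d != 0 /\ forall x, D x -> R (d * x).

Definition ideal (D I : K -> Prop) : Prop :=
  subset_of I D /\ I 0 /\ (forall x y, I x -> I y -> I (x + y)) /\
  (forall r x, D r -> I x -> I (r * x)).

Definition nonzero (I : K -> Prop) : Prop := exists x, I x /\ x != 0.

Definition maximal_ideal (D M : K -> Prop) : Prop :=
  ideal D M /\ ~ M 1 /\
  forall J, ideal D J -> subset_of M J -> ~ J 1 -> subset_of J M.

Definition prod_set (A B : K -> Prop) : K -> Prop := fun x =>
  exists s : seq (K * K), (forall p, p \in s -> A p.1 /\ B p.2) /\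
    x = \sum_(p <- s) p.1 * p.2.

Definition fg_ideal (D I : K -> Prop) : Prop :=
  ideal D I /\ exists s : seq K, (forall a, a \in s -> D a) /\
    forall x, I x <-> exists c : seq K, (forall y, y \in c -> D y) /\
       size c = size s /\ x = \sum_(i < size s) c`_i * s`_i.

Definition loc (D M : K -> Prop) : K -> Prop := fun x =>
  exists a b, D a /\ D b /\ ~ M b /\ x = a / b.

Definition principal (D J : K -> Prop) : Prop :=
  exists g, forall x, J x <-> exists d, D d /\ x = g * d.

Definition locally_principal (D I : K -> Prop) : Prop :=
  forall M, maximal_ideal D M -> principal (loc D M) (prod_set I (loc D M)).

Definition colon (A I : K -> Prop) : K -> Prop := fun x =>
  forall i, I i -> A (x * i).

Definition invertible (D I : K -> Prop) : Prop :=
  set_eq (prod_set I (colon D I)) D.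

Definition LPI (D : K -> Prop) : Prop :=
  forall I, ideal D I -> nonzero I -> locally_principal D I -> invertible D I.

Definition E (I : K -> Prop) : K -> Prop := colon I I.

Definition stable (I : K -> Prop) : Prop := invertible (E I) I.

Definition finitely_stable (R : K -> Prop) : Prop :=
  forall I, fg_ideal R I -> nonzero I -> stable I.

Definition finite_character (R : K -> Prop) : Prop :=
  forall x, R x -> x != 0 ->
    exists Ms : seq (K -> Prop), forall M, maximal_ideal R M -> M x ->
      exists N, List.In N Ms /\ set_eq M N.

End Defs.

(* Main.v *)
(** Suppose a nonzero [a] lies in infinitely many maximal ideals.  Then [a] lies
    in all members of a sequence [I n] of proper finitely generated pairwise
    comaximal ideals: either some finitely generated ideal can be split into two
    comaximal ones over and over again, or every finitely generated proper ideal
    containing [a] lies in one that is contained in a unique maximal ideal.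
    The sum [D] of the rings [E (I n)] is a ring because the [I n] are
    comaximal, and it is fractional because [a] multiplies it into [R].  Each
    [I n] extends to an invertible ideal of [D], with inverse generated by
    [B n = (E (I n) : I n)], and the sum [J] of the [B n] is locally principal
    over [D] because a maximal ideal of [D] contains at most one [I n].  As [D]
    is an LPI-domain, [a J] is invertible, so [J] is generated by finitely many
    of the [B n], which is absurd modulo the next [I n]. *)
Require Import Defs.
From HB Require Import structures.
From mathcomp Require Import all_boot all_order all_algebra.
From mathcomp Require Import ring.
From Stdlib Require Import Classical ClassicalEpsilon.

Set Implicit Arguments. Unset Strict Implicit. Unset Printing Implicit Defensive.
Import GRing.Theory.
Local Open Scope ring_scope.

(** * Submodules of the field, comaximality, and localization at [1 + I] *)

Definition submodule (K : fieldType) (R A : K -> Prop) : Prop :=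
  A 0 /\ (forall x y, A x -> A y -> A (x + y)) /\
  (forall r x, R r -> A x -> A (r * x)).

Definition comaximal (K : fieldType) (A B : K -> Prop) : Prop :=
  exists x y, A x /\ B y /\ x + y = 1.

(** Applied to a union of submodules this is their sum. *)
Inductive add_closure (K : fieldType) (A : K -> Prop) : K -> Prop :=
| add_closure_in x : A x -> add_closure A x
| add_closure0 : add_closure A 0
| add_closureD x y : add_closure A x -> add_closure A y -> add_closure A (x + y).

(* The elements of [K] lying in the localization of [A] at [1 + I]. *)
Definition near (K : fieldType) (R I A : K -> Prop) : K -> Prop := fun x =>
  exists v, R v /\ I (1 - v) /\ A (v * x).

Definition adjoin (K : fieldType) (R I : K -> Prop) (x : K) : K -> Prop :=
  fun z => exists i r, I i /\ R r /\ z = i + r * x.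

Section Generalities.
Variable K : fieldType.
Implicit Types R A B I J M : K -> Prop.

Lemma ideal_submodule R I : ideal R I -> submodule R I.
Proof. by case=> _ []. Qed.

Lemma subring_submodule R : subring R -> submodule R R.
Proof. by move=> [R0 [_ [_ [RD RM]]]]. Qed.

Lemma submodule_opp R A x : subring R -> submodule R A -> A x -> A (- x).
Proof.
move=> [R0 [R1 [RB _]]] [_ [_ AM]] Ax.
by rewrite -mulN1r; apply: AM => //; rewrite -(sub0r 1); apply: RB.
Qed.

Lemma subring_compl R x : subring R -> R x -> R (1 - x).
Proof. by move=> [_ [R1 [RB _]]] Rx; apply: RB. Qed.

Lemma comaximal_sym A B : comaximal A B -> comaximal B A.
Proof. by move=> [x [y [Ax [By e]]]]; exists y, x; rewrite addrC. Qed.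

Lemma prod_set_mul A B x y : A x -> B y -> prod_set A B (x * y).
Proof.
move=> Ax By; exists [:: (x, y)]; split; last by rewrite big_seq1.
by move=> p; rewrite inE => /eqP->.
Qed.

Lemma prod_set_ind A B (P : K -> Prop) :
  P 0 -> (forall x y, P x -> P y -> P (x + y)) ->
  (forall x y, A x -> B y -> P (x * y)) ->
  forall x, prod_set A B x -> P x.
Proof.
move=> P0 PD PM x [s [hs ->]]; elim: s hs => [|p s IH] hs; first by rewrite big_nil.
rewrite big_cons; apply: PD.
  by have [] := hs p (mem_head _ _); apply: PM.
by apply: IH => q qs; apply: hs; rewrite inE qs orbT.
Qed.

Lemma add_closure_mul A (P : K -> Prop) c :
  P 0 -> (forall x y, P x -> P y -> P (x + y)) ->
  (forall x, A x -> P (c * x)) -> forall x, add_closure A x -> P (c * x).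
Proof.
move=> P0 PD PA x; elim=> {x} [x /PA //||x y _ Px _ Py]; first by rewrite mulr0.
by rewrite mulrDr; apply: PD.
Qed.

(** The set [1 + I] is closed under products, so the product of two multipliers serves for a sum. *)
Lemma near_submodule R S I A : subring R -> ideal R I -> subset_of R S ->
  submodule S A -> submodule S (near R I A).
Proof.
move=> sR [IR [I0 [ID IM]]] RS [A0 [AD AM]].
have [R0 [R1 [RB [RD RM]]]] := sR.
split; [|split].
- by exists 1; rewrite subrr mulr0.
- move=> x y [v [Rv [Iv Av]]] [w [Rw [Iw Aw]]]; exists (v * w).
  split; first exact: RM.
  split.
    have -> : 1 - v * w = (1 - v) + v * (1 - w) by ring.
    by apply: ID => //; apply: IM.
  have -> : v * w * (x + y) = w * (v * x) + v * (w * y) by ring.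
  by apply: AD; apply: AM => //; apply: RS.
- move=> r x Sr [v [Rv [Iv Av]]]; exists v; split=> //; split=> //.
  by rewrite mulrCA; apply: AM.
Qed.

Lemma near_sub R I A : subring R -> ideal R I -> subset_of A (near R I A).
Proof.
move=> [_ [R1 _]] [_ [I0 _]] x Ax; exists 1.
by rewrite subrr mul1r.
Qed.

Lemma near_near R I A B : subring R -> ideal R I ->
  subset_of A (near R I B) -> subset_of (near R I A) (near R I B).
Proof.
move=> [_ [_ [_ [_ RM]]]] [_ [_ [ID IM]]] AB x [v [Rv [Iv Av]]].
have [w [Rw [Iw Bw]]] := AB _ Av.
exists (w * v); rewrite -mulrA; split; first exact: RM.
split=> //.
have -> : 1 - w * v = (1 - w) + w * (1 - v) by ring.
by apply: ID => //; apply: IM.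
Qed.

(** Each ideal of the list contains an element congruent to 1 modulo [J]; the product of these is
    [y]. *)
Lemma comaximal_all R J (l : list (K -> Prop)) : subring R -> ideal R J ->
  (forall I, List.In I l -> ideal R I /\ comaximal I J) ->
  exists y, R y /\ J (1 - y) /\ forall I, List.In I l -> I y.
Proof.
move=> sR [JR [J0 [JD JM]]]; have [R0 [R1 [RB [RD RM]]]] := sR.
elim: l => [|I l IH] hl; first by exists 1; rewrite subrr.
have [|y [Ry [Jy hy]]] := IH; first by move=> I' hI'; apply: hl; right.
have [[IR [I0 [ID IM]]] [u [v [Iu [Jv uv]]]]] := hl I (or_introl erefl).
exists (u * y); split; first by apply: RM => //; apply: IR.
split.
  have -> : 1 - u * y = (1 - y) + y * v by rewrite -(addrK v u) uv; ring.
  by apply: JD => //; apply: JM.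
move=> I' [<-|hI']; first by rewrite mulrC; apply: IM.
have [[_ [_ [_ IM']]] _] := hl I' (or_intror hI').
by apply: IM'; [apply: IR|apply: hy].
Qed.

Lemma adjoin_ideal R I x : subring R -> ideal R I -> R x ->
  ideal R (adjoin R I x).
Proof.
move=> [R0 [R1 [RB [RD RM]]]] [IR [I0 [ID IM]]] Rx.
split; [|split; [|split]].
- by move=> z [i [r [Ii [Rr ->]]]]; apply: RD; [apply: IR|apply: RM].
- by exists 0, 0; rewrite mul0r addr0.
- move=> _ _ [i [r [Ii [Rr ->]]]] [j [s [Ij [Rs ->]]]].
  exists (i + j), (r + s); split; first exact: ID.
  by split; [apply: RD|ring].
- move=> t _ Rt [i [r [Ii [Rr ->]]]]; exists (t * i), (t * r).
  by split; [apply: IM|split; [apply: RM|ring]].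
Qed.

Lemma sub_adjoin R I x : subring R -> subset_of I (adjoin R I x).
Proof. by move=> [R0 _] z Iz; exists z, 0; rewrite mul0r addr0. Qed.

Lemma mem_adjoin R I x : subring R -> ideal R I -> adjoin R I x x.
Proof.
by move=> [_ [R1 _]] [_ [I0 _]]; exists 0, 1; rewrite mul1r add0r.
Qed.

Lemma adjoin_sub R I J x : ideal R J -> subset_of I J -> J x ->
  subset_of (adjoin R I x) J.
Proof.
move=> [_ [_ [JD JM]]] IJ Jx _ [i [r [Ii [Rr ->]]]].
by apply: JD; [apply: IJ|apply: JM].
Qed.

Lemma maximal_ideal_comaximal R M x : subring R -> maximal_ideal R M -> R x ->
  ~ M x -> exists r, R r /\ M (1 - r * x).
Proof.
move=> sR [iM [M1 Mmax]] Rx nMx; have [MR [M0 [MD MM]]] := iM.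
have [R0 [R1 [RB [RD RM]]]] := sR.
apply: NNPP => h; apply: nMx.
apply: (Mmax (adjoin R M x)); last exact: mem_adjoin.
- exact: adjoin_ideal.
- exact: sub_adjoin.
- move=> [i [r [Mi [Rr e]]]]; apply: h; exists r; split=> //.
  by rewrite e addrK.
Qed.

Lemma maximal_ideal_prime R M x y : subring R -> maximal_ideal R M ->
  R x -> R y -> M (x * y) -> M x \/ M y.
Proof.
move=> sR mM Rx Ry Mxy; case: (classic (M x)) => [|nMx]; first by left.
have [r [Rr Mr]] := maximal_ideal_comaximal sR mM Rx nMx.
have [[MR [M0 [MD MM]]] _] := mM.
right; have -> : y = y * (1 - r * x) + r * (x * y) by ring.
by apply: MD; apply: MM.
Qed.

Lemma maximal_ideals_comaximal R M N : subring R -> maximal_ideal R M ->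
  maximal_ideal R N -> ~ set_eq M N -> comaximal N M.
Proof.
move=> sR mM mN neq; apply: NNPP => h; apply: neq.
suff NM : subset_of N M.
  move=> x; split; last exact: NM.
  by have [iM [M1 _]] := mM; have [_ [_ Nmax]] := mN; apply: Nmax.
move=> x Nx; apply: NNPP => nMx.
have [[NR [_ [_ NM]]] _] := mN.
have [r [Rr Mr]] := maximal_ideal_comaximal sR mM (NR _ Nx) nMx.
by apply: h; exists (r * x), (1 - r * x); split; [apply: NM|split=> //; ring].
Qed.

Lemma loc_add R M x y : subring R -> maximal_ideal R M ->
  loc R M x -> loc R M y -> loc R M (x + y).
Proof.
move=> sR mM [a [b [Ra [Rb [Mb ->]]]]] [c [d [Rc [Rd [Md ->]]]]].
have [R0 [R1 [RB [RD RM]]]] := sR; have [[_ [M0 _]] _] := mM.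
have b0 : b != 0 by apply: contra_notN Mb => /eqP->.
have d0 : d != 0 by apply: contra_notN Md => /eqP->.
exists (a * d + c * b), (b * d); split; first by apply: RD; apply: RM.
split; first exact: RM.
split; first by case/(maximal_ideal_prime sR mM Rb Rd).
by field; rewrite b0 d0.
Qed.

Lemma loc_mul R M x y : subring R -> maximal_ideal R M ->
  loc R M x -> loc R M y -> loc R M (x * y).
Proof.
move=> sR mM [a [b [Ra [Rb [Mb ->]]]]] [c [d [Rc [Rd [Md ->]]]]].
have [R0 [R1 [RB [RD RM]]]] := sR.
exists (a * c), (b * d); split; first exact: RM.
split; first exact: RM.
split; first by case/(maximal_ideal_prime sR mM Rb Rd).
by rewrite invfM mulrACA.
Qed.

Lemma loc0 R M : subring R -> maximal_ideal R M -> loc R M 0.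
Proof.
move=> [R0 [R1 _]] [_ [M1 _]].
by exists 0, 1; rewrite mul0r.
Qed.

(** Multiples of [g] by local elements are closed under sums and local factors, so testing the
    elements of [A] suffices. *)
Lemma principal_loc R M A g : subring R -> maximal_ideal R M -> A g ->
  (forall x, A x -> exists d, loc R M d /\ x = g * d) ->
  principal (loc R M) (prod_set A (loc R M)).
Proof.
move=> sR mM Ag hA; exists g => x; split; last first.
  by move=> [d [Ld ->]]; apply: prod_set_mul.
move: x; apply: prod_set_ind.
- by exists 0; rewrite mulr0; split=> //; apply: loc0.
- move=> _ _ [d [Ld ->]] [e [Le ->]]; exists (d + e).
  by rewrite mulrDr; split=> //; apply: loc_add.
- move=> _ e /hA[d [Ld ->]] Le; exists (d * e).
  by rewrite mulrA; split=> //; apply: loc_mul.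
Qed.

Lemma fg_adjoin R I x : subring R -> fg_ideal R I -> R x ->
  fg_ideal R (adjoin R I x).
Proof.
move=> sR [iI [s [Rs hs]]] Rx; split; first exact: adjoin_ideal.
exists (x :: s); split; first by move=> y; rewrite inE => /orP[/eqP->|/Rs].
move=> z; split.
  move=> [i [r [/hs[c [Rc [sc ->]]] [Rr ->]]]]; exists (r :: c); split.
    by move=> y; rewrite inE => /orP[/eqP->|/Rc].
  by split; [rewrite /= sc|rewrite big_ord_recl addrC].
move=> [[|r c] [Rc [sc ->]]]; first by [].
exists (\sum_(i < size s) c`_i * s`_i), r; split.
  apply/hs; exists c; split; last by case: sc.
  by move=> y yc; apply: Rc; rewrite inE yc orbT.
by split; [apply: Rc; rewrite mem_head|rewrite big_ord_recl addrC].
Qed.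

Lemma fg_zero R : subring R -> fg_ideal R (fun x => x = 0).
Proof.
move=> [R0 _]; split.
  split; first by move=> x ->.
  by split=> //; split=> [x y -> ->|r x _ ->]; rewrite ?addr0 ?mulr0.
exists [::]; split=> // x; split=> [->|[c [_ [_ ->]]]]; rewrite ?big_ord0 //.
by exists [::]; rewrite big_ord0.
Qed.

End Generalities.

(** * Infinitely many pairwise comaximal ideals through [a] *)

(** For an ideal [J] this says that [R / J] is a local ring: of two elements with sum 1, one is a
    unit modulo [J]. *)
Definition homogeneous (K : fieldType) (R J : K -> Prop) : Prop :=
  ~ J 1 /\ forall x y, R x -> R y -> x + y = 1 -> adjoin R J x 1 \/ adjoin R J y 1.

(* For a homogeneous [J] this is the only maximal ideal containing [J]. *)
Definition homogeneous_radical (K : fieldType) (R J : K -> Prop) : K -> Prop :=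
  fun x => R x /\ ~ adjoin R J x 1.

Section ComaximalSequence.
Variable K : fieldType.
Implicit Types R I J M : K -> Prop.

(** The nonunits of the local ring [R / J] form its maximal ideal. *)
Lemma homogeneous_radical_maximal R J : subring R -> ideal R J ->
  homogeneous R J -> maximal_ideal R (homogeneous_radical R J).
Proof.
move=> sR iJ [J1 hJ]; have [R0 [R1 [RB [RD RM]]]] := sR.
have [JR [J0 [JD JM]]] := iJ.
split; [split; [|split; [|split]]|split].
- by move=> x [].
- by split=> // -[i [r [Ji [_ e]]]]; apply: J1; rewrite e mulr0 addr0.
- move=> x y [Rx nx] [Ry ny]; split; first exact: RD.
  move=> [i [r [Ji [Rr e]]]].
  (* Regrouping [i + r * (x + y) = 1] gives two elements with sum 1; one is a unit modulo [J], hence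
     so is [x] or [y]. *)
  have Rix : R (i + r * x) by apply: RD; [apply: JR|apply: RM].
  have e1 : (i + r * x) + r * y = 1 by rewrite e; ring.
  case: (hJ _ _ Rix (RM _ _ Rr Ry) e1).
  + move=> h; apply: nx; move: h; apply: adjoin_sub; first exact: adjoin_ideal.
      exact: sub_adjoin.
    by exists i, r.
  + move=> h; apply: ny; move: h; apply: adjoin_sub; first exact: adjoin_ideal.
      exact: sub_adjoin.
    by exists 0, r; rewrite add0r.
- move=> r x Rr [Rx nx]; split; first exact: RM.
  move=> h; apply: nx; move: h; apply: adjoin_sub; first exact: adjoin_ideal.
    exact: sub_adjoin.
  by exists 0, r; rewrite add0r.
- by move=> [_ []]; apply: mem_adjoin.
(* [L] contains [J], whose elements are nonunits modulo [J], hence also [J + R x]; as [L] is proper,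
   [x] is a nonunit. *)
- move=> L iL sL nL1 x Lx; have [LR _] := iL; split; first exact: LR.
  apply: contra_not nL1; apply: adjoin_sub => // j Jj; apply: sL.
  split; first exact: JR.
  apply: contra_not J1; exact: adjoin_sub.
Qed.

(** Dependent choice: [G] is an invariant of the list of terms chosen so far, newest first, which
    guarantees a next term. *)
Lemma incremental_sequence (T : Type) (G : list T -> Prop) (Q : T -> Prop)
    (C : T -> T -> Prop) :
  G nil ->
  (forall l, G l ->
     exists t, Q t /\ (forall s, List.In s l -> C s t) /\ G (t :: l)) ->
  exists f : nat -> T,
    (forall n, Q (f n)) /\ forall m n, (m < n)%N -> C (f m) (f n).
Proof.
move=> G0 step.
have inhT : inhabited T by have [t _] := step _ G0; apply: inhabits.
pose next l := epsilon inhT (fun t =>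
  Q t /\ (forall s, List.In s l -> C s t) /\ G (t :: l)).
have nextP l : G l ->
    Q (next l) /\ (forall s, List.In s l -> C s (next l)) /\ G (next l :: l).
  by move=> Gl; apply: (epsilon_spec inhT _ (step l Gl)).
pose L n := iter n (fun l => next l :: l) nil.
have GL n : G (L n) by elim: n => //= n /nextP[_ []].
exists (fun n => next (L n)); split=> [n|m n mn]; first by have [] := nextP _ (GL n).
have [_ [h _]] := nextP _ (GL n); apply: h.
elim: n mn => // n IH; rewrite ltnS leq_eqVlt => /orP[/eqP->|/IH]; first by left.
by right.
Qed.

Lemma exists_comaximal_sequence R a : subring R -> R a ->
  (forall Ms : list (K -> Prop), exists M, maximal_ideal R M /\ M a /\
     forall N, List.In N Ms -> ~ set_eq M N) ->
  exists I : nat -> K -> Prop,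
    (forall n, fg_ideal R (I n) /\ ~ I n 1 /\ I n a) /\
    forall m n, m <> n -> comaximal (I m) (I n).
Proof.
move=> sR Ra infM; have [R0 [R1 [RB [RD RM]]]] := sR.
pose Q J := fg_ideal R J /\ ~ J 1 /\ J a.
(* It remains to find an invariant for [incremental_sequence]; it differs in the two cases below. *)
suff [G [G0 Gstep]] : exists G : list (K -> Prop) -> Prop, G nil /\
    forall l, G l -> exists J, Q J /\
      (forall I, List.In I l -> comaximal I J) /\ G (J :: l).
  have [f [Qf Cf]] := incremental_sequence G0 Gstep.
  exists f; split=> // m n /eqP; rewrite neq_ltn => /orP[/Cf //|/Cf].
  exact: comaximal_sym.
have Q_adjoin J x : Q J -> R x -> ~ adjoin R J x 1 -> Q (adjoin R J x).
  move=> [fJ [_ Ja]] Rx nx; split; first exact: fg_adjoin.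
  by split=> //; apply: sub_adjoin.
case: (classic (exists I0, Q I0 /\ forall J, Q J -> subset_of I0 J ->
    ~ homogeneous R J)) => [[I0 [QI0 split0]]|noI0].
  (* The invariant keeps a remainder [J] comaximal with all chosen ideals. As [J] is not
     homogeneous, it grows to two proper comaximal ideals: one is the next term, the other the new
     remainder. *)
  exists (fun l => exists J, Q J /\ subset_of I0 J /\
    forall I, List.In I l -> comaximal I J).
  split; first by exists I0; split=> //; split.
  move=> l [J [QJ [I0J CJ]]].
  have [fJ [nJ1 Ja]] := QJ; have [iJ _] := fJ.
  have [x [y [Rx [Ry [xy [nx ny]]]]]] : exists x y, R x /\ R y /\ x + y = 1 /\
      ~ adjoin R J x 1 /\ ~ adjoin R J y 1.
    apply: NNPP => h; apply: (split0 J QJ I0J); split=> // x y Rx Ry xy.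
    case: (classic (adjoin R J x 1)) => [|nx]; first by left.
    right; apply: NNPP => ny; apply: h; exists x, y.
    by split=> //; split=> //; split.
  have CJz z I : List.In I l -> comaximal I (adjoin R J z).
    move=> /CJ[u [v [Iu [Jv uv]]]]; exists u, v; split=> //.
    by split=> //; apply: sub_adjoin.
  exists (adjoin R J x); split; first exact: Q_adjoin.
  split; first exact: CJz.
  exists (adjoin R J y); split; first exact: Q_adjoin.
  split; first by move=> z /I0J; apply: sub_adjoin.
  move=> I [<-|]; last exact: CJz.
  by exists x, y; split; [|split=> //]; apply: mem_adjoin.
(* Here all chosen ideals are homogeneous, and a maximal ideal [M] through [a] distinct from their
   radicals yields the next one. *)
exists (fun l => forall J, List.In J l -> ideal R J /\ homogeneous R J).
split=> // l hl.
have [M [mM [Ma nM]]] := infM (List.map (homogeneous_radical R) l).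
have [iM [nM1 _]] := mM; have [MR _] := iM.
(* The element [y] vanishes modulo the earlier radicals and is 1 modulo [M]. *)
have [y [Ry [My hy]]] : exists y, R y /\ M (1 - y) /\ forall N,
    List.In N (List.map (homogeneous_radical R) l) -> N y.
  apply: comaximal_all => // N hN; have := nM N hN.
  move: hN => /List.in_map_iff[J [<- /hl[iJ hJ]]] neq.
  have mN := homogeneous_radical_maximal sR iJ hJ.
  split; first by have [] := mN.
  exact: (maximal_ideals_comaximal sR mM mN neq).
have Ry1 := subring_compl sR Ry.
pose A := adjoin R (adjoin R (fun x => x = 0) a) (1 - y).
have fA : fg_ideal R A by do 2! [apply: fg_adjoin => //]; apply: fg_zero.
have i0 : ideal R (fun x : K => x = 0) by case: (fg_zero sR).
have AM : subset_of A M.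
  apply: adjoin_sub => //; apply: adjoin_sub => // x ->.
  by case: iM => _ [].
have Aa : A a by apply: sub_adjoin => //; apply: mem_adjoin.
have Ay : A (1 - y) by apply: mem_adjoin => //; apply: adjoin_ideal.
have [T [QT [AT hT]]] : exists T, Q T /\ subset_of A T /\ homogeneous R T.
  apply: NNPP => h; apply: noI0; exists A; split.
    by split=> //; split=> // /AM.
  by move=> J QJ AJ hJ; apply: h; exists J.
exists T; split=> //; split; last first.
  by move=> J [<-|/hl //]; split=> //; case: QT => -[].
move=> J lJ; have [iJ hJ] := hl J lJ.
have Ny : homogeneous_radical R J y by apply: hy; apply: List.in_map.
have [_ [nN1 _]] := homogeneous_radical_maximal sR iJ hJ.
have [[_ [_ [ND _]]] _] := homogeneous_radical_maximal sR iJ hJ.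
have [[_ [_ [_ TM]]] _] : fg_ideal R T by case: QT.
(* If [1 - y] were in the radical of [J], so would be 1, since [y] is. So [1 - y] is a unit modulo
   [J], and it lies in [T]: the two are comaximal. *)
have : adjoin R J (1 - y) 1.
  apply: NNPP => h; apply: nN1; rewrite -(subrK y 1); apply: ND => //.
move=> [j [r [Jj [Rr e]]]]; exists j, (r * (1 - y)).
by split=> //; split=> //; apply: TM => //; apply: AT.
Qed.

End ComaximalSequence.

(** * The sum [D] of the rings [E (I n)] and the sum [J] of the inverses [B n] *)

Section StableSequence.
Variables (K : fieldType) (R : K -> Prop) (a : K) (I : nat -> K -> Prop).
Hypothesis sR : subring R.
Hypothesis a0 : a != 0.
Hypothesis iI : forall n, ideal R (I n).
Hypothesis I1 : forall n, ~ I n 1.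
Hypothesis Ia : forall n, I n a.
Hypothesis coI : forall m n, m <> n -> comaximal (I m) (I n).
Hypothesis stI : forall n, stable (I n).

Let B n : K -> Prop := colon (E (I n)) (I n).
Let D : K -> Prop := add_closure (fun x => exists n, E (I n) x).
Let J : K -> Prop := add_closure (fun x => exists n, B n x).
(** The factor [a] moves the [D]-module [J] into [D], so that [LPI D] can be applied. *)
Let aJ : K -> Prop := fun x => exists j, J j /\ x = a * j.

Let IR n x : I n x -> R x. Proof. by have [h _] := iI n; apply: h. Qed.
Let ID n x y : I n x -> I n y -> I n (x + y).
Proof. by have [_ [_ [h _]]] := iI n; apply: h. Qed.
Let IM n x y : R x -> I n y -> I n (x * y).
Proof. by have [_ [_ [_ h]]] := iI n; apply: h. Qed.

Let RE n x : R x -> E (I n) x.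
Proof. by move=> Rx i; apply: IM. Qed.

Let E_D n x : E (I n) x -> D x.
Proof. by move=> Ex; apply: add_closure_in; exists n. Qed.

Let RD x : R x -> D x.
Proof. by move=> Rx; apply: (@E_D 0%N); apply: RE. Qed.

Let B_J n x : B n x -> J x.
Proof. by move=> Bx; apply: add_closure_in; exists n. Qed.

Lemma subring_E n : subring (E (I n)).
Proof.
have [R0 [R1 [RB _]]] := sR.
split; first exact: RE.
split; first exact: RE.
split=> [x y Ex Ey i Ii|].
  rewrite mulrBl; apply: ID; first exact: Ex.
  by apply: (submodule_opp sR (ideal_submodule (iI n))); apply: Ey.
split=> x y Ex Ey i Ii; first by rewrite mulrDl; apply: ID; [apply: Ex|apply: Ey].
by rewrite -mulrA; apply: Ex; apply: Ey.
Qed.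

Let EB n x : E (I n) x -> B n x.
Proof.
move=> Ex i Ii; have [_ [_ [_ [_ EM]]]] := subring_E n.
by apply: EM => //; apply: RE; apply: (IR Ii).
Qed.

Let submodule_B n : submodule (E (I n)) (B n).
Proof.
have [E0 [E1 [_ [ED EM]]]] := subring_E n.
split; first exact: EB.
split=> [x y Bx By i Ii|r x Er Bx i Ii].
  by rewrite mulrDl; apply: ED; [apply: Bx|apply: By].
by rewrite -mulrA; apply: EM => //; apply: Bx.
Qed.

Let D_J x : D x -> J x.
Proof.
elim=> {x} [x [n /EB/B_J //]||x y _ Jx _ Jy]; first exact: add_closure0.
exact: add_closureD.
Qed.

(** With [1 = u + v], [u] in [I m] and [v] in [I n], both [x * u] and [y * v] fall into [R], so each
    half of [x * y] stays in a single ring. *)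
Lemma mul_E_D m n x y : E (I m) x -> E (I n) y -> D (x * y).
Proof.
move=> Ex Ey; have [e|ne] := eqVneq m n.
  subst m; apply: (@E_D n); have [_ [_ [_ [_ EM]]]] := subring_E n; exact: EM.
have [u [v [Iu [Iv uv]]]] := coI (elimN eqP ne).
have -> : x * y = (x * u) * y + (y * v) * x.
  by rewrite -[LHS]mulr1 -uv; ring.
apply: add_closureD.
  apply: (@E_D n); have [_ [_ [_ [_ EM]]]] := subring_E n; apply: EM => //.
  by apply: RE; apply: (IR (Ex _ Iu)).
apply: (@E_D m); have [_ [_ [_ [_ EM]]]] := subring_E m; apply: EM => //.
by apply: RE; apply: (IR (Ey _ Iv)).
Qed.

Lemma subring_sum_E : subring D.
Proof.
have [R0 [R1 [RB _]]] := sR.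
have DM x y : D x -> D y -> D (x * y).
  move=> Dx; move: y; apply: add_closure_mul; [exact: add_closure0|exact: add_closureD|].
  move=> y [n Ey]; rewrite mulrC; move: x Dx.
  apply: add_closure_mul; [exact: add_closure0|exact: add_closureD|].
  by move=> x [m Ex]; apply: mul_E_D Ey Ex.
split; first exact: RD.
split; first exact: RD.
split; last by split=> //; apply: add_closureD.
move=> x y Dx Dy; apply: add_closureD => //.
by rewrite -mulN1r; apply: DM => //; apply: RD; rewrite -(sub0r 1); apply: RB.
Qed.

Lemma fractional_sum_E : R a -> fractional_overring R D.
Proof.
move=> Ra; split; first by split; [exact: subring_sum_E|exact: RD].
have [R0 [_ [_ [RA _]]]] := sR.
exists a; split=> //; split=> //; apply: add_closure_mul => // x [n Ex].
by rewrite mulrC; apply: (@IR n); apply: Ex.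
Qed.

(** The same splitting of 1: [x * u] lies in [R] and keeps [y] in [B n], while [y * v] lies in
    [E (I n)], where [mul_E_D] applies. *)
Lemma mul_D_J x y : D x -> J y -> J (x * y).
Proof.
move=> Dx; move: y.
apply: add_closure_mul; [exact: add_closure0|exact: add_closureD|].
move=> y [n By]; rewrite mulrC; move: x Dx.
apply: add_closure_mul; [exact: add_closure0|exact: add_closureD|].
move=> x [m Ex]; have [_ [_ BM]] := submodule_B n.
have [e|ne] := eqVneq m n.
  by subst m; rewrite mulrC; apply: (@B_J n); apply: BM.
have [u [v [Iu [Iv uv]]]] := coI (elimN eqP ne).
have -> : y * x = (x * u) * y + x * (y * v).
  by rewrite -[LHS]mulr1 -uv; ring.
apply: add_closureD.
  by apply: (@B_J n); apply: BM => //; apply: RE; apply: (IR (Ex _ Iu)).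
by apply: D_J; apply: mul_E_D Ex (By _ Iv).
Qed.

Lemma ideal_aJ : ideal D aJ.
Proof.
split.
  move=> _ [j [Jj ->]]; move: j Jj.
  apply: add_closure_mul; [exact: add_closure0|exact: add_closureD|].
  by move=> x [n Bx]; rewrite mulrC; apply: (@E_D n); apply: Bx.
split; first by exists 0; rewrite mulr0; split=> //; apply: add_closure0.
split.
  move=> _ _ [j [Jj ->]] [k [Jk ->]]; exists (j + k).
  by rewrite mulrDr; split=> //; apply: add_closureD.
move=> r _ Dr [j [Jj ->]]; exists (r * j).
by rewrite mulrCA; split=> //; apply: mul_D_J.
Qed.

Let J1 : J 1.
Proof. by apply: D_J; apply: RD; case: sR => _ []. Qed.

Lemma nonzero_aJ : nonzero aJ.
Proof. by exists a; split=> //; exists 1; rewrite mulr1. Qed.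

Lemma B_invertible n : prod_set (I n) (B n) 1.
Proof. by apply/stI; apply: RE; case: sR => _ []. Qed.

Lemma locally_principal_aJ : locally_principal D aJ.
Proof.
move=> M mM; have sD := subring_sum_E.
have [iM [M1 _]] := mM; have [MD [M0 [MA MM]]] := iM.
have [D0 [D1 [DB [DA DM]]]] := sD.
(* The local generator is [a * b]: for [j] in any [B m], [j = b * (c * (v * j) / (v * (c * b)))],
   with numerator in [D] and denominator outside [M]. *)
suff [b [c [Jb [Dcb [Mcb hb]]]]] : exists b c, J b /\ D (c * b) /\ ~ M (c * b) /\
    forall m j, B m j -> exists v, D v /\ ~ M v /\ D (c * (v * j)).
  have cb0 : c * b != 0 by apply: contra_notN Mcb => /eqP->.
  have [c0 b0] : c != 0 /\ b != 0.
    by move: cb0; rewrite mulf_eq0 negb_or => /andP[].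
  apply: (@principal_loc _ _ _ _ (a * b)) => //; first by exists b.
  move=> _ [j [Jj ->]].
  suff [d [Ld ->]] : exists d, loc D M d /\ j = b * d by exists d; rewrite mulrA.
  elim: Jj => {j} [j [m Bj]||x y _ [d [Ld ->]] _ [e [Le ->]]]; last 2 first.
  - by exists 0; rewrite mulr0; split=> //; apply: loc0.
  - by exists (d + e); rewrite mulrDr; split=> //; apply: loc_add.
  have [v [Dv [Mv Dcvj]]] := hb m j Bj.
  have v0 : v != 0 by apply: contra_notN Mv => /eqP->.
  exists (c * (v * j) / (v * (c * b))); split.
    exists (c * (v * j)), (v * (c * b)); split=> //.
    split; first exact: DM.
    split=> //; by case/(maximal_ideal_prime sD mM Dv Dcb).
  by field; rewrite v0 b0 c0.
case: (classic (exists n, subset_of (I n) M)) => [[n InM]|noI].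
  (* Products of elements of [I n] and [B n] sum to 1, so one of them avoids [M]. *)
  have [c [b [Ic [Bb Mcb]]]] : exists c b, I n c /\ B n b /\ ~ M (c * b).
    apply: NNPP => h; apply: M1; move: (B_invertible n).
    apply: prod_set_ind => // x y Ix By; apply: NNPP => nM.
    by apply: h; exists x, y.
  exists b, c; split; first exact: (B_J Bb).
  split; first by rewrite mulrC; apply: (@E_D n); apply: Bb.
  split=> // m j Bj; have [e|ne] := eqVneq m n.
    subst m; exists 1; split=> //; split=> //.
    by rewrite mul1r mulrC; apply: (@E_D n); apply: Bj.
  (* As [u] lies in [I n] and so in [M], [v] is outside [M]; moreover [v * j] lies in [E (I m)]. *)
  have [v [u [Iv [Iu uv]]]] := coI (elimN eqP ne).
  exists v; split; first exact: RD (IR Iv).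
  split; first by move=> Mv; apply: M1; rewrite -uv; apply: MA => //; apply: InM.
  apply: DM; first exact: RD (IR Ic).
  by rewrite mulrC; apply: (@E_D m); apply: Bj.
(* No [I m] lies in [M], so [J] agrees with [D] locally at [M]. *)
exists 1, 1; rewrite mulr1; split=> //; split=> //; split=> // m j Bj.
have [v [Iv Mv]] : exists v, I m v /\ ~ M v.
  apply: NNPP => h; apply: noI; exists m => v Iv; apply: NNPP => Mv.
  by apply: h; exists v.
exists v; split; first exact: RD (IR Iv).
by split=> //; rewrite mul1r mulrC; apply: (@E_D m); apply: Bj.
Qed.

(** * Localization at [1 + I n] and the failure of invertibility *)

Let near_D n : submodule D (near R (I n) D).
Proof.
exact: (near_submodule sR (iI n) RD (subring_submodule subring_sum_E)).
Qed.

Let near_E n : submodule R (near R (I n) (E (I n))).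
Proof.
apply: (near_submodule sR (iI n) (fun x h => h)).
have [E0 [E1 [_ [EA EM]]]] := subring_E n.
by split=> //; split=> // r x Rr; apply: EM; apply: RE.
Qed.

Lemma mem_near m n (A : K -> Prop) x : m <> n ->
  (forall v, I m v -> A (v * x)) -> near R (I n) A x.
Proof.
move=> ne hA; have [v [u [Iv [Iu uv]]]] := coI ne.
exists v; split; first exact: (IR Iv).
by split; [rewrite -uv addrC addKr|apply: hA].
Qed.

(** For [m <> n], an element of [I m] congruent to 1 modulo [I n] multiplies [E (I m)] into [R], so
    only [E (I n)] survives. *)
Lemma D_near n : subset_of D (near R (I n) (E (I n))).
Proof.
have [N0 [ND _]] := near_E n.
move=> x; elim=> {x} [x [m Ex]|//|x y _ Nx _ Ny]; last exact: ND.
have [e|ne] := eqVneq m n; first by subst m; apply: near_sub.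
apply: (mem_near (elimN eqP ne)) => v Iv; apply: RE.
by rewrite mulrC; apply: (IR (Ex _ Iv)).
Qed.

(** An element of [J] involves finitely many [B m]; for [n] beyond their indices, multipliers from
    the [I m] bring it into [D]. *)
Lemma J_near x : J x -> exists N, forall n, (N <= n)%N -> near R (I n) D x.
Proof.
elim=> {x} [x [m Bx]||x y _ [N Nx] _ [N' Ny]].
- exists m.+1 => n mn; apply: (@mem_near m) => [e|v Iv].
    by rewrite e ltnn in mn.
  by rewrite mulrC; apply: (@E_D m); apply: Bx.
- by exists 0%N => n _; have [] := near_D n.
- exists (maxn N N') => n; rewrite geq_max => /andP[/Nx Nn /Ny Nn'].
  by have [_ [ND _]] := near_D n; apply: ND.
Qed.

(** Invertibility expresses 1 through finitely many elements of [J]. For [N] beyond the indices they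
    involve, [B N] lies near [E (I N)], so 1, being in [I N * B N], lies near [I N], which forces it
    into [I N]. *)
Lemma not_invertible_aJ : ~ invertible D aJ.
Proof.
move=> inv; have D1 : D 1 by apply: RD; case: sR => _ [].
(* The form [b * 1] lets 1 be generalized to any element of the product of [aJ] and [colon D aJ],
   for induction over sums. *)
have [N hN] : exists N, forall n, (N <= n)%N ->
    forall b, B n b -> near R (I n) D (b * 1).
  move: (1) ((inv 1).2 D1); apply: prod_set_ind.
  - by exists 0%N => n _ b _; rewrite mulr0; have [] := near_D n.
  - move=> x y [N Nx] [N' Ny]; exists (maxn N N') => n.
    rewrite geq_max => /andP[Nn Nn'] b Bb; rewrite mulrDr.
    by have [_ [ND _]] := near_D n; apply: ND; [apply: Nx|apply: Ny].
  - move=> _ c [j [Jj ->]] Cc; have [N Nj] := J_near Jj.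
    exists N => n Nn b Bb.
    have -> : b * (a * j * c) = c * (a * b) * j by ring.
    have [_ [_ NM]] := near_D n; apply: NM; last exact: Nj.
    by apply: Cc; exists b; split=> //; apply: (B_J Bb).
have [v [Rv [Iv Iv1]]] : near R (I N) (I N) 1.
  have sN := near_submodule sR (iI N) (fun x h => h) (ideal_submodule (iI N)).
  have [N0 [ND NM]] := sN.
  move: (B_invertible N); apply: prod_set_ind => // i b Ii Bb.
  have [v [Rv [Iv Ev]]] : near R (I N) (E (I N)) b.
    apply: (near_near sR (iI N) (@D_near N)).
    by rewrite -[b]mulr1; apply: hN.
  by exists v; split=> //; split=> //; rewrite mulrCA mulrC; apply: Ev.
(* Both [v] and [1 - v] lie in [I N]. *)
by apply: (I1 (n := N)); rewrite -(subrK v 1); apply: ID => //; rewrite -[v]mulr1.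
Qed.

Lemma not_LPI_sum_E : ~ LPI D.
Proof.
move=> lpi; apply: not_invertible_aJ; apply: lpi.
- exact: ideal_aJ.
- exact: nonzero_aJ.
- exact: locally_principal_aJ.
Qed.

End StableSequence.

Theorem theorem12 (K : fieldType) (R : K -> Prop) :
  subring R -> is_quotient_field R -> (exists x : K, ~ R x) ->
  finitely_stable R -> LPI R ->
  (forall D : K -> Prop, fractional_overring R D -> LPI D) ->
  finite_character R.
Proof.
move=> sR _ _ fsR _ lpi a Ra a0; apply: NNPP => nfin.
have [|I [hI coI]] := exists_comaximal_sequence sR Ra.
  move=> Ms; apply: NNPP => h; apply: nfin; exists Ms => M mM Ma.
  apply: NNPP => hN; apply: h; exists M; split=> //; split=> // N NMs eMN.
  by apply: hN; exists N.
have fI n : fg_ideal R (I n) by have [] := hI n.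
have iI n : ideal R (I n) by have [] := fI n.
have I1 n : ~ I n 1 by have [_ []] := hI n.
have Ia n : I n a by have [_ []] := hI n.
have stI n : stable (I n) by apply: fsR => //; exists a.
apply: (@not_LPI_sum_E K R a I) => //; apply: lpi.
exact: (@fractional_sum_E K R a I).
Qed.
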